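(* Let $d\in\{1,2,3,\ldots\}$ and let $p$ be a pdf on $\mathbb{R}^d$ that is continuous almost everywhere (with respect to Lebesgue measure). Then $p$ has a smooth non-negative Lipschitz spectrum.
   Context: A pdf on $\mathbb{R}^d$ is an a.e. non-negative function on $\mathbb{R}^d$ with Lebesgue integral equal to one; ''almost everywhere'' (a.e.) always refers to Lebesgue measure, and equalities and inequalities of functions mean equality and inequality a.e. For functions $f_1,\ldots,f_d:\mathbb{R}\to\mathbb{R}$, $\prod_{j=1}^d f_j$ denotes the function $(x_1,\ldots,x_d)\mapsto f_1(x_1)\cdots f_d(x_d)$ on $\mathbb{R}^d$. Definition. A pdf $p$ on $\mathbb{R}^d$ has a non-negative Lipschitz spectrum (NL-spectrum) $(w,L)$, with $w=(w_i)_{i=1}^\infty$ and $L=(L_i)_{i=1}^\infty$, if $$p=\sum_{i=1}^\infty w_i\prod_{j=1}^d p_{i,j},$$ where $(w_i)_{i=1}^\infty$ is a non-negative sequence with $\sum_{i=1}^\infty w_i=1$ and $w_1>0$, and the $p_{i,j}$ ($i\ge 1$, $1\le j\le d$) are Lipschitz continuous pdfs on $\mathbb{R}$ with Lipschitz constant $L_i$, i.e. $|p_{i,j}(x)-p_{i,j}(y)|\le L_i|x-y|$ for all $x,y\in\mathbb{R}$. The NL-spectrum is called smooth if the marginals $p_{i,j}$ in this decomposition are all smooth ($C^\infty$). *)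

(* Defs.v *)
From HB Require Import structures.
From mathcomp Require Import all_boot all_order all_algebra.
From mathcomp Require Import all_classical all_reals all_analysis.
From mathcomp Require Import measurable_realfun.

Set Implicit Arguments.
Unset Strict Implicit.
Unset Printing Implicit Defensive.
Import Order.TTheory GRing.Theory Num.Theory.
Import numFieldNormedType.Exports.
Local Open Scope classical_set_scope.
Local Open Scope ring_scope.

(* Row vectors carry the product of the Borel sigma-algebras of the
   coordinates, as tuples do in the library; this is the Borel
   sigma-algebra of R^n. *)
Section measurable_rV.
Variables (R : realType) (n : nat).

Definition rV_coord (i : 'I_n) (x : 'rV[R]_n) : R := x ord0 i.

Let rV_set0 : g_sigma_preimage rV_coord set0.
Proof. exact: sigma_algebra0. Qed.

Let rV_setC A : g_sigma_preimage rV_coord A -> g_sigma_preimage rV_coord (~` A).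
Proof. exact: sigma_algebraC. Qed.

Let rV_bigcup (F : (set 'rV[R]_n)^nat) :
  (forall i, g_sigma_preimage rV_coord (F i)) ->
  g_sigma_preimage rV_coord (\bigcup_i (F i)).
Proof. exact: sigma_algebra_bigcup. Qed.

HB.instance Definition _ := @isMeasurable.Build
  (measure_tuple_display default_measure_display) 'rV[R]_n
  (g_sigma_preimage rV_coord) rV_set0 rV_setC rV_bigcup.

Lemma measurable_rV_coord (i : 'I_n) : measurable_fun setT (rV_coord i).
Proof.
move=> _ Y mY; rewrite setTI; apply: sub_sigma_algebra => /=.
rewrite -bigcup_seq/=; exists i => /=; first by rewrite mem_index_enum.
by exists Y => //; rewrite setTI.
Qed.

Lemma measurable_fun_rV d (T : measurableType d) (f : T -> 'rV[R]_n) :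
  (forall i, measurable_fun setT (rV_coord i \o f)) -> measurable_fun setT f.
Proof.
move=> mf _ Y mY; rewrite setTI.
have : preimage_set_system setT f (g_sigma_preimage rV_coord) (f @^-1` Y).
  by exists Y => //; rewrite setTI.
rewrite -[X in X _]g_sigma_preimageE; apply: smallest_sub.
  exact: sigma_algebra_measurable.
move=> _ [C HC <-].
move: HC; rewrite -bigcup_seq/= => -[i _ [B mB <-]].
by have := mf i measurableT B mB; rewrite !setTI comp_preimage.
Qed.

End measurable_rV.

Section lebesgue_rV.
Variable R : realType.
Local Notation leb := (@lebesgue_measure R).

Definition rV_cons n (z : R * 'rV[R]_n) : 'rV[R]_n.+1 :=
  row_mx (z.1%:M : 'rV[R]_1) z.2.

Definition rV_uncons n (x : 'rV[R]_n.+1) : R * 'rV[R]_n :=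
  (x ord0 ord0, \row_j x ord0 (lift ord0 j)).

Lemma rV_cons0 n (z : R * 'rV[R]_n) : rV_cons z ord0 ord0 = z.1.
Proof.
rewrite /rV_cons; have -> : (ord0 : 'I_n.+1) = lshift n (ord0 : 'I_1) by exact/val_inj.
by rewrite [LHS]row_mxEl mxE eqxx mulr1n.
Qed.

Lemma rV_consS n (z : R * 'rV[R]_n) j :
  rV_cons z ord0 (lift ord0 j) = z.2 ord0 j.
Proof.
rewrite /rV_cons; have -> : lift ord0 j = rshift 1 j by exact/val_inj.
by rewrite [LHS]row_mxEr.
Qed.

Lemma rV_consK n : cancel (@rV_cons n) (@rV_uncons n).
Proof.
move=> z; rewrite /rV_uncons rV_cons0 [RHS]surjective_pairing; congr pair.
by apply/rowP => j; rewrite mxE rV_consS.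
Qed.

Lemma measurable_rV_cons n : measurable_fun setT (@rV_cons n).
Proof.
apply: measurable_fun_rV => i; case: (unliftP ord0 i) => [j|] ->.
  rewrite (_ : _ \o _ = rV_coord j \o snd); last first.
    by apply/funext => z /=; rewrite /rV_coord rV_consS.
  exact: (measurableT_comp (measurable_rV_coord j)).
rewrite (_ : _ \o _ = fst); last first.
  by apply/funext => z /=; rewrite /rV_coord rV_cons0.
exact: measurable_fst.
Qed.

Lemma measurable_rV_uncons n : measurable_fun setT (@rV_uncons n).
Proof.
apply: measurable_fun_pair => /=; first exact: measurable_rV_coord.
apply: measurable_fun_rV => j.
rewrite (_ : _ \o _ = rV_coord (lift ord0 j)); first exact: measurable_rV_coord.
by apply/funext => x; rewrite /= /rV_coord mxE.
Qed.

Section step.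
Variables (n : nat) (mu : {sigma_finite_measure set 'rV[R]_n -> \bar R}).

Definition lebesgue_rV_step : set 'rV[R]_n.+1 -> \bar R :=
  pushforward (leb \x mu)%E (@rV_cons n).

Let mcons := @measurable_rV_cons n.

Let step0 : lebesgue_rV_step set0 = 0%E. Proof. exact: measure0. Qed.

Let step_ge0 A : (0 <= lebesgue_rV_step A)%E. Proof. exact: measure_ge0. Qed.

Let step_sigma_additive : semi_sigma_additive lebesgue_rV_step.
Proof. exact: measure_semi_sigma_additive. Qed.

HB.instance Definition _ := isMeasure.Build _ _ _ lebesgue_rV_step
  step0 step_ge0 step_sigma_additive.

Let step_sigma_finite : sigma_finite setT lebesgue_rV_step.
Proof.
have /sigma_finiteP[F [TF ndF Foo]] := sigma_finiteT leb.
have /sigma_finiteP[G [TG ndG Goo]] := sigma_finiteT mu.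
exists (fun k => @rV_uncons n @^-1` (F k `*` G k)).
  apply/seteqP; split => // x _.
  have [k _ Fk] : (\bigcup_k F k) (x ord0 ord0) by rewrite -TF.
  have [l _ Gl] : (\bigcup_k G k) (rV_uncons x).2 by rewrite -TG.
  exists (maxn k l) => //; split.
    have /subsetPset : (F k <= F (maxn k l))%O by exact/ndF/leq_maxl.
    by apply.
  have /subsetPset : (G l <= G (maxn k l))%O by exact/ndG/leq_maxr.
  by apply.
move=> k; have [mF Fk] := Foo k; have [mG Gk] := Goo k; split.
  rewrite -[X in measurable X]setTI; apply: measurable_rV_uncons => //.
  exact: measurableX.
rewrite /lebesgue_rV_step /pushforward -comp_preimage.
rewrite (_ : _ \o _ = id); last by apply/funext => z; exact: rV_consK.
by rewrite preimage_id product_measure1E// lte_mul_pinfty// ge0_fin_numE.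
Qed.

HB.instance Definition _ := Measure_isSigmaFinite.Build _ _ _ lebesgue_rV_step
  step_sigma_finite.

End step.

(* Product of n copies of the Lebesgue measure of R, carried along the
   identification [rV_cons] of R * R^n with R^(n+1). *)
Fixpoint lebesgue_rV n : {sigma_finite_measure set 'rV[R]_n -> \bar R} :=
  if n is m.+1 then lebesgue_rV_step (lebesgue_rV m)
  else \d_(0 : 'rV[R]_0).

Lemma lebesgue_rV_box n (a b : 'rV[R]_n) : (forall j, a ord0 j <= b ord0 j) ->
  lebesgue_rV n [set x : 'rV[R]_n | forall j, a ord0 j < x ord0 j <= b ord0 j] =
  (\prod_(j < n) (b ord0 j - a ord0 j))%:E.
Proof.
elim: n a b => [|n IH] a b ab.
  rewrite big_ord0 /= diracE mem_set//= => -[].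
  by [].
pose a' := (rV_uncons a).2; pose b' := (rV_uncons b).2.
rewrite big_ord_recl /= /lebesgue_rV_step /pushforward.
transitivity ((leb \x lebesgue_rV n)%E (`]a ord0 ord0, b ord0 ord0] `*`
    [set x : 'rV[R]_n | forall j, a' ord0 j < x ord0 j <= b' ord0 j])).
  congr (_ \x _)%E; apply/seteqP; split => [z /= Hz|z /= [z1 z2] j].
    split; first by have := Hz ord0; rewrite rV_cons0 in_itv.
    by move=> j; have := Hz (lift ord0 j); rewrite rV_consS !mxE.
  have [k ->|->] := unliftP ord0 j.
    by have := z2 k; rewrite rV_consS !mxE.
  by rewrite rV_cons0; move: z1; rewrite in_itv.
rewrite product_measure1E//.
  rewrite IH => [|j]; last by rewrite !mxE.
  rewrite EFinM; congr *%E.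
    rewrite [LHS]lebesgue_measure_itv/= lte_fin.
    have := ab ord0; rewrite le_eqVlt => /predU1P[->|->]; last by rewrite EFinB.
    by rewrite ltxx subrr.
  by congr EFin; apply: eq_bigr => j _; rewrite !mxE.
rewrite [X in measurable X](_ : _ =
  \bigcap_(j in [set: 'I_n]) (rV_coord j @^-1` `]a' ord0 j, b' ord0 j])).
  apply: fin_bigcap_measurable => // j _.
  by rewrite -[X in measurable X]setTI; exact: measurable_rV_coord.
apply/seteqP; split => x /= Hx j; last first.
  by have := Hx j I; rewrite /= in_itv.
by move=> _; rewrite /= in_itv; exact: Hx.
Qed.

End lebesgue_rV.

(* The sigma-algebras at hand are the Borel ones, while a density is only
   Lebesgue measurable: preimages of Borel sets are Borel sets up to a
   negligible set. The integral of such a function computed over Borel simple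
   functions is its integral with respect to the completed measure. *)
Definition is_pdf (R : realType) d (T : measurableType d)
    (mu : {measure set T -> \bar R}) (f : T -> R) : Prop :=
  [/\ forall Y : set R, measurable Y -> completed_algebra_gen mu (f @^-1` Y),
      {ae mu, forall x, 0 <= f x} &
      (\int[mu]_x (f x)%:E = 1)%E].

Definition smooth (R : realType) (f : R -> R) : Prop :=
  forall k x, derivable (derive1n k f) x 1.

(* [w], [L] and [q] are indexed from 0, so that [w 0] is the first weight. *)
Definition nl_decomposition (R : realType) d (p : 'rV[R]_d -> R)
    (w L : R^nat) (q : nat -> 'I_d -> R -> R) : Prop :=
  [/\ (forall i, 0 <= w i) /\ 0 < w 0,
      series w @ \oo --> (1 : R),
      forall i j, is_pdf (@lebesgue_measure R) (q i j),
      forall i j, (L i).-lipschitz (q i j) &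
      {ae lebesgue_rV R d, forall x : 'rV[R]_d,
        series (fun i => w i * \prod_(j < d) q i j (x ord0 j)) @ \oo --> p x}].

Definition has_NL_spectrum (R : realType) d (p : 'rV[R]_d -> R)
    (w L : R^nat) : Prop :=
  exists q, nl_decomposition p w L q.

Definition has_smooth_NL_spectrum (R : realType) d (p : 'rV[R]_d -> R)
    (w L : R^nat) : Prop :=
  exists2 q, nl_decomposition p w L q & forall i j, smooth (q i j).

(* Main.v *)
Require Import Defs.
From mathcomp Require Import all_boot all_order all_algebra.
From mathcomp Require Import all_classical all_reals all_analysis.
From mathcomp Require Import measurable_realfun ring lra.
Import Order.TTheory GRing.Theory Num.Theory.
Import numFieldNormedType.Exports.
Local Open Scope classical_set_scope.
Local Open Scope ring_scope.
Set Implicit Arguments.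
Unset Strict Implicit.

(* Let f = max(p, 0), which is continuous and equal to p off a null set. A
   smooth bump whose integer translates sum to 1 gives, at mesh 1/a, product
   bumps on a grid of cubes; weighting each by the infimum of f over its
   support gives a finite mixture below f, and these mixtures converge to f at
   every continuity point as a grows. By dominated convergence a finite
   mixture u <= f of mass at least 1 - e thus exists. Since f - u is again
   non-negative and continuous off the same null set, u can be enlarged
   repeatedly so that the masses tend to 1 while the mixtures stay below f;
   their increasing limit is below f and has the same integral, hence equals f
   almost everywhere. *)

(** * A smooth bump generating a partition of unity *)

(** The recursion passes to the derivative, so that closure under sums, products, inverses and
    affine substitutions follows by induction on the order. *)
Fixpoint derivable_upto (R : realType) (k : nat) (f : R -> R) : Prop :=
  if k is k'.+1 then (forall x, derivable f x 1) /\ derivable_upto k' (derive1 f)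
  else True.

Lemma smoothP (R : realType) (f : R -> R) :
  smooth f <-> forall k, derivable_upto k f.
Proof.
split=> [sf k|sf k].
  elim: k f sf => //= k IH f sf; split; first exact: (sf 0%N).
  by apply: IH => j x; rewrite -derive1Sn; exact: sf.
elim: k f sf => [|k IH] f sf; first by have [] := sf 1%N.
move=> x; rewrite derive1Sn; apply: IH => j.
by have [] := sf j.+1.
Qed.

Lemma derivable_uptoS (R : realType) k (f g : R -> R) :
  (forall x : R, is_derive x (1 : R) f (g x)) -> derivable_upto k g ->
  derivable_upto k.+1 f.
Proof.
move=> fg Dg; split=> [x|]; first by have [] := fg x.
rewrite (_ : (derive1 f) = g)//; apply/funext => x.
by rewrite derive1E; have [_ ->] := fg x.
Qed.

Lemma derivable_uptoW (R : realType) k (f : R -> R) :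
  derivable_upto k.+1 f -> derivable_upto k f.
Proof.
by elim: k f => //= k IH f [df Df]; split => //; exact: IH.
Qed.

Lemma derivable_upto_is_derive (R : realType) k (f : R -> R) (x : R) :
  derivable_upto k.+1 f -> is_derive x (1 : R) f (derive1 f x).
Proof. by move=> [df _]; rewrite derive1E; exact: DeriveDef. Qed.

Lemma derivable_uptoD (R : realType) k (f g : R -> R) :
  derivable_upto k f -> derivable_upto k g ->
  derivable_upto k (fun x => f x + g x).
Proof.
elim: k f g => // k IH f g Df Dg.
apply: (@derivable_uptoS _ _ _ (fun x => derive1 f x + derive1 g x)).
  move=> x; have := derivable_upto_is_derive x Df.
  have := derivable_upto_is_derive x Dg => ? ?; exact: is_deriveD.
by apply: IH; [case: Df|case: Dg].
Qed.

Lemma derivable_uptoM (R : realType) k (f g : R -> R) :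
  derivable_upto k f -> derivable_upto k g ->
  derivable_upto k (fun x => f x * g x).
Proof.
elim: k f g => // k IH f g Df Dg.
apply: (@derivable_uptoS _ _ _ (fun x => f x * derive1 g x + g x * derive1 f x)).
  move=> x; have := derivable_upto_is_derive x Df.
  have := derivable_upto_is_derive x Dg => ? ?; exact: is_deriveM.
apply: derivable_uptoD; apply: IH => //;
  by [exact: derivable_uptoW | case: Df | case: Dg].
Qed.

Lemma derivable_upto_cst (R : realType) k (c : R) :
  derivable_upto k (fun=> c).
Proof.
elim: k c => // k IH c.
by apply: (@derivable_uptoS _ _ _ (fun=> 0)) => // x; exact: is_derive_cst.
Qed.

Lemma derivable_uptoV (R : realType) k (f : R -> R) :
  (forall x, f x != 0) -> derivable_upto k f ->
  derivable_upto k (fun x => (f x)^-1).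
Proof.
move=> f0; elim: k => // k IH Df.
(* The derivative of 1/f is written as a product involving 1/f and f', to which the induction
   hypothesis and closure under products apply. *)
apply: (@derivable_uptoS _ _ _ (fun x => - 1 * ((f x)^-1 * ((f x)^-1 * derive1 f x)))).
  move=> x; have H := derivable_upto_is_derive x Df.
  apply: (is_derive_eq (is_deriveV (f0 x) H)).
  by rewrite /GRing.scale/= expr2 invfM !mulNr mul1r !mulrA.
apply: derivable_uptoM; first exact: derivable_upto_cst.
have DV := IH (derivable_uptoW Df).
by do 2 (apply: derivable_uptoM => //); case: Df.
Qed.

Lemma derivable_upto_affine (R : realType) k (f : R -> R) (a b : R) :
  derivable_upto k f -> derivable_upto k (fun x => f (a * x + b)).
Proof.
elim: k f => // k IH f Df.
apply: (@derivable_uptoS _ _ _ (fun x => derive1 f (a * x + b) * a)).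
  move=> x; have H := derivable_upto_is_derive (a * x + b) Df.
  have H2 : is_derive x (1 : R) (fun x => a * x + b) a.
    have D := is_deriveD (is_deriveM (is_derive_cst a x 1) (is_derive_id x (1 : R)))
      (is_derive_cst b x 1).
    apply: (is_derive_eq D).
    by rewrite addr0 scaler0 addr0 /GRing.scale/= mulr1.
  exact: (@is_derive1_comp R f (fun x => a * x + b) x _ _ H H2).
by apply: derivable_uptoM; [apply: IH; case: Df|exact: derivable_upto_cst].
Qed.

(* The derivative of [flat_exp n] is a combination of [flat_exp n.+1] and
   [flat_exp n.+2], so that smoothness of the family follows by induction. *)
Definition flat_exp (R : realType) (n : nat) (x : R) : R :=
  if 0 < x then x^-1 ^+ n * expR (- x^-1) else 0.

Lemma flat_exp_ge0 (R : realType) n (x : R) : 0 <= flat_exp n x.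
Proof.
rewrite /flat_exp; case: ltP => // x0.
by rewrite mulr_ge0 ?expR_ge0// exprn_ge0// invr_ge0 ltW.
Qed.

(** For y = 1/x > 0, the exponential series gives exp(y) >= y^(n+2) / (n+2)!. The exponent n+2
    leaves a factor x^2, which forces a zero derivative at 0. *)
Lemma flat_exp_quad (R : realType) n (x : R) :
  flat_exp n x <= n.+2`!%:R * x ^+ 2.
Proof.
rewrite /flat_exp; case: ltP => x0; last by rewrite mulr_ge0// sqr_ge0.
have y0 : 0 < x^-1 by rewrite invr_gt0.
rewrite expRN ler_pdivrMr ?expR_gt0//.
have h : x^-1 ^+ n.+2 / n.+2`!%:R <= expR x^-1.
  by rewrite (le_trans _ (expR_ge1Dxn n.+1 (ltW y0)))// lerDr.
have f0 : 0 < n.+2`!%:R :> R by rewrite ltr0n fact_gt0.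
rewrite (_ : x^-1 ^+ n = n.+2`!%:R * x ^+ 2 * (x^-1 ^+ n.+2 / n.+2`!%:R)).
  by rewrite ler_pM2l// mulr_gt0// exprn_gt0.
move: f0; move: (n.+2`!%:R) => c c0.
rewrite !exprVn !exprS; field.
by rewrite expf_neq0 !gt_eqF.
Qed.

Lemma is_derive0_quad (R : realType) (f : R -> R) (C : R) :
  (forall x, `|f x| <= C * x ^+ 2) -> is_derive (0 : R) (1 : R) f 0.
Proof.
move=> fC.
have f0 : f 0 = 0.
  by apply/eqP; rewrite -normr_le0; have := fC 0; rewrite expr2 !mulr0.
have H : h^-1 *: (f (h *: 1 + 0) - f 0) @[h --> 0^'] --> (0 : R).
  apply/cvgrPdist_le => e e0; rewrite near_withinE.
  near=> h => h0.
  rewrite sub0r normrN f0 subr0 addr0 [h *: 1]mulr1 normrM normfV.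
  rewrite ler_pdivrMl ?normr_gt0// (le_trans (fC h))//.
  rewrite -real_normK ?num_real// expr2 mulrCA ler_wpM2l//.
  (* Adding 1 makes the constant positive, so that it can be divided by. *)
  have C0 : 0 < `|C| + 1 by rewrite ltr_wpDl.
  apply: (@le_trans _ _ ((`|C| + 1) * `|h|)).
    by rewrite ler_wpM2r// (le_trans (ler_norm _))// lerDl.
  rewrite -ler_pdivlMl//; near: h.
  have : 0 < (`|C| + 1)^-1 * e by rewrite mulr_gt0// invr_gt0.
  move=> /(@nbhs0_le R R); apply.
by apply: DeriveDef; [apply/cvg_ex; exists 0|exact/cvg_lim].
Unshelve. all: by end_near. Qed.

(** Away from 0 the function agrees locally with 0 or with its closed form; at 0 the quadratic bound
    gives derivative 0, the value of the formula there. *)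
Lemma is_derive_flat_exp (R : realType) n (x : R) :
  is_derive x (1 : R) (flat_exp n) (- n%:R * flat_exp n.+1 x + flat_exp n.+2 x).
Proof.
have [x0|x0|->] := ltgtP x 0.
- apply: (@near_eq_is_derive _ _ _ (cst 0)); last first.
    rewrite /flat_exp !ltNge (ltW x0)/= mulr0 addr0; exact: is_derive_cst.
  near=> y; rewrite /flat_exp ltNge.
  suff -> : y <= 0 by [].
  by apply/ltW; near: y; exact: lt_nbhsl.
- apply: (@near_eq_is_derive R R R (fun y : R => y^-1 ^+ n * expR (- y^-1))); last first.
    have xN : x != 0 by rewrite gt_eqF.
    have D1 : is_derive x (1 : R) (fun y : R => y^-1) (- x ^- 2 *: 1).
      by apply: is_deriveV => //; exact: is_derive_id.
    have D2 : is_derive x (1 : R) (fun y : R => expR (- y^-1)) (expR (- x^-1) * (x ^- 2)).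
      apply: is_derive1_comp => //.
      have := is_deriveN D1; rewrite scaleNr opprK [_ *: 1]mulr1; exact.
    have D3 : is_derive x (1 : R) (fun y : R => y^-1 ^+ n)
        ((n%:R * x^-1 ^+ n.-1) *: (- x ^- 2 *: 1)).
      have := is_deriveX n D1; rewrite exprfctE; exact.
    apply: (is_derive_eq (is_deriveM D3 D2)).
    rewrite /flat_exp x0 /GRing.scale/= mulr1.
    case: n D3 => [|n] _ /=; rewrite ?exprS; field; rewrite ?exprS; by rewrite xN.
  near=> y; rewrite /flat_exp ifT//.
  by near: y; exact: lt_nbhsr.
- apply: is_derive_eq.
    apply: (@is_derive0_quad _ _ n.+2`!%:R) => y.
    by rewrite ger0_norm ?flat_exp_ge0// flat_exp_quad.
  by rewrite /flat_exp ltxx mulr0 addr0.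
Unshelve. all: by end_near. Qed.

Lemma derivable_upto_flat_exp (R : realType) k n :
  derivable_upto k (@flat_exp R n).
Proof.
elim: k n => // k IH n.
apply: derivable_uptoS; first exact: is_derive_flat_exp.
by apply: derivable_uptoD => //; apply: derivable_uptoM => //; exact: derivable_upto_cst.
Qed.

(* The form [- 1 * x + 1] of [1 - x] matches [derivable_upto_affine]. *)
Definition smooth_step (R : realType) (x : R) : R :=
  flat_exp 0 x * (flat_exp 0 x + flat_exp 0 (- 1 * x + 1))^-1.

(** x and 1 - x are never both non-positive, so one summand is a positive exponential. *)
Lemma smooth_step_den_gt0 (R : realType) (x : R) :
  0 < flat_exp 0 x + flat_exp 0 (- 1 * x + 1).
Proof.
have [x0|x0] := ltP 0 x.
  by rewrite ltr_pwDl ?flat_exp_ge0// /flat_exp x0 expr0 mul1r expR_gt0.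
rewrite ltr_wpDl ?flat_exp_ge0// /flat_exp ifT; last by lra.
by rewrite expr0 mul1r expR_gt0.
Qed.

Lemma derivable_upto_smooth_step (R : realType) k :
  derivable_upto k (@smooth_step R).
Proof.
apply: derivable_uptoM; first exact: derivable_upto_flat_exp.
apply: derivable_uptoV.
  by move=> x; rewrite gt_eqF// smooth_step_den_gt0.
apply: derivable_uptoD; first exact: derivable_upto_flat_exp.
apply: derivable_upto_affine; exact: derivable_upto_flat_exp.
Qed.

Lemma smooth_step_le0 (R : realType) (x : R) : x <= 0 -> smooth_step x = 0.
Proof. by move=> x0; rewrite /smooth_step {1}/flat_exp ltNge x0 mul0r. Qed.

Lemma smooth_step_ge1 (R : realType) (x : R) : 1 <= x -> smooth_step x = 1.
Proof.
move=> x1; have := smooth_step_den_gt0 x; rewrite /smooth_step.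
rewrite (_ : flat_exp 0 (- 1 * x + 1) = 0).
  by rewrite addr0 => h; rewrite divff// gt_eqF.
by rewrite /flat_exp ltNge ifF//; apply/negbF; lra.
Qed.

Lemma smooth_step_itv (R : realType) (x : R) : 0 <= smooth_step x <= 1.
Proof.
rewrite /smooth_step ler_pdivrMr ?smooth_step_den_gt0//.
rewrite mul1r lerDl flat_exp_ge0 andbT.
by rewrite mulr_ge0 ?flat_exp_ge0// invr_ge0 ltW// smooth_step_den_gt0.
Qed.

(** A step minus its translate by 1: integer translates telescope, and the bump vanishes outside (0,
    2). The explicit factors [- 1] and [1] fit the closure lemmas. *)
Definition smooth_bump (R : realType) (x : R) : R :=
  smooth_step x + - 1 * smooth_step (1 * x - 1).

Lemma smooth_bumpE (R : realType) (x : R) :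
  smooth_bump x = smooth_step x - smooth_step (x - 1).
Proof. by rewrite /smooth_bump mul1r mulN1r. Qed.

Lemma derivable_upto_smooth_bump (R : realType) k : derivable_upto k (@smooth_bump R).
Proof.
apply: derivable_uptoD; first exact: derivable_upto_smooth_step.
apply: derivable_uptoM; first exact: derivable_upto_cst.
exact/derivable_upto_affine/derivable_upto_smooth_step.
Qed.

(** For x <= 1 the translated step vanishes; for x >= 1 the first step equals 1, its largest
    value. *)
Lemma smooth_bump_ge0 (R : realType) (x : R) : 0 <= smooth_bump x.
Proof.
rewrite smooth_bumpE subr_ge0; have [x1|/ltW x1] := leP x 1.
  rewrite (@smooth_step_le0 _ (x - 1)); last by lra.
  by have /andP[] := smooth_step_itv x.
by rewrite (smooth_step_ge1 x1); have /andP[] := smooth_step_itv (x - 1).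
Qed.

Lemma smooth_bump_eq0 (R : realType) (x : R) : (x <= 0) || (2 <= x) -> smooth_bump x = 0.
Proof.
rewrite smooth_bumpE => /orP[x0|x2].
  by rewrite !smooth_step_le0 ?subrr//; lra.
by rewrite !smooth_step_ge1 ?subrr//; lra.
Qed.

Lemma smooth_bump_gt0 (R : realType) : 0 < @smooth_bump R 1.
Proof. by rewrite smooth_bumpE smooth_step_ge1// smooth_step_le0 ?subrr// subr0. Qed.

Lemma sum_smooth_bump (R : realType) (M : nat) (y : R) :
  \sum_(z < M) smooth_bump (y - z%:R) = smooth_step y - smooth_step (y - M%:R).
Proof.
elim: M => [|M IH]; first by rewrite big_ord0 subr0 subrr.
rewrite big_ord_recr /= IH smooth_bumpE -natr1.
rewrite (_ : y - M%:R - 1 = y - (M%:R + 1)); last by ring.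
ring.
Qed.

(** * Rescaled bumps as Lipschitz densities *)

Lemma derivable_upto_continuous (R : realType) (f : R -> R) :
  derivable_upto 1 f -> continuous f.
Proof.
by move=> [df _] x; apply/differentiable_continuous/derivable1_diffP/df.
Qed.

Lemma derive1_eq0_out (R : realType) (f : R -> R) (a b x : R) :
  (forall y, (y < a) || (b < y) -> f y = 0) -> (x < a) || (b < x) ->
  derive1 f x = 0.
Proof.
move=> f0 xab; rewrite derive1E -(derive_cst (0 : R) x (1 : R)).
apply: near_eq_derive; move: xab => /orP[xa|bx].
  by near=> y; rewrite f0//; apply/orP; left; near: y; exact: lt_nbhsl.
by near=> y; rewrite f0//; apply/orP; right; near: y; exact: lt_nbhsr.
Unshelve. all: by end_near. Qed.

(** Order 2 makes the derivative continuous, hence bounded on [a, b]; it vanishes outside, and the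
    mean value theorem turns the bound into a Lipschitz constant. *)
Lemma compact_support_lipschitz (R : realType) (f : R -> R) (a b : R) :
  a <= b -> derivable_upto 2 f ->
  (forall y, (y < a) || (b < y) -> f y = 0) -> exists L : R, L.-lipschitz f.
Proof.
move=> ab Df f0; have [df Ddf] := Df.
have cdf : {within `[a, b], continuous (fun x => `|derive1 f x|)}.
  apply: continuous_subspaceT => x; apply: cvg_norm.
  exact: (derivable_upto_continuous Ddf).
have [c _ cM] := EVT_max ab cdf.
have fM x : `|derive1 f x| <= `|derive1 f c|.
  have [xab|] := boolP (x \in `[a, b]); first exact: cM.
  rewrite in_itv/= negb_and -!ltNge => xab.
  by rewrite (derive1_eq0_out f0 xab) normr0.
have lip x y : x <= y -> `|f y - f x| <= `|derive1 f c| * `|y - x|.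
  move=> xy; have [| |z _ ->] := @MVT_segment R f (derive1 f) x y xy.
  - by move=> z _; exact: (derivable_upto_is_derive z Df).
  - exact/continuous_subspaceT/derivable_upto_continuous/derivable_uptoW.
  - by rewrite normrM ler_wpM2r.
exists `|derive1 f c| => -[x y] _ /=.
have [xy|/ltW yx] := leP x y; last exact: lip.
by rewrite distrC (distrC x); exact: lip.
Qed.

(** Compact support gives finiteness; for positivity, f is at least f(c)/2 on some ball around c. *)
Lemma compact_support_integral (R : realType) (f : R -> R) (a b c : R) :
  continuous f -> (forall y, 0 <= f y) ->
  (forall y, (y < a) || (b < y) -> f y = 0) -> 0 < f c ->
  exists2 I : R, 0 < I & (\int[@lebesgue_measure R]_x (f x)%:E = I%:E)%E.
Proof.
move=> cf f_ge0 f0 fc.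
have mf : measurable_fun [set: R] (EFin \o f).
  by apply/measurable_EFinP; exact: continuous_measurable_fun.
have intE : (\int[@lebesgue_measure R]_x (f x)%:E =
             \int[@lebesgue_measure R]_(x in `[a, b]) (f x)%:E)%E.
  rewrite [RHS]integral_mkcond; apply: eq_integral => x _.
  rewrite /= patchE; case: ifPn => //.
  rewrite notin_setE/= in_itv/= => /negP; rewrite negb_and -!ltNge => xab.
  by rewrite f0.
have : (\int[@lebesgue_measure R]_x (f x)%:E)%E \is a fin_num.
  rewrite intE; apply: integrable_fin_num => //.
  apply: continuous_compact_integrable; first exact: segment_compact.
  exact: continuous_subspaceT.
move=> /fineK fI; exists (fine (\int[@lebesgue_measure R]_x (f x)%:E)%E) => //.
rewrite -lte_fin fI.
have /cvgrPdist_lt /(_ (f c / 2)) := cf c.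
rewrite divr_gt0// => /(_ isT) [e /= e0 He].
have : (\int[@lebesgue_measure R]_(x in ball c e) (f c / 2)%:E <=
        \int[@lebesgue_measure R]_x (f x)%:E)%E.
  apply: (@le_trans _ _ (\int[@lebesgue_measure R]_(x in ball c e) (f x)%:E)%E).
    apply: ge0_le_integral => //.
    - exact: measurable_ball.
    - by move=> x _; rewrite lee_fin divr_ge0// ltW.
    - exact: measurable_funS mf.
    - move=> x /He; rewrite lee_fin => h.
      have := ler_norm (f c - f x); lra.
  apply: ge0_subset_integral => //; first exact: measurable_ball.
  by move=> x _; rewrite lee_fin.
apply: lt_le_trans.
rewrite integral_cst//; last exact: measurable_ball.
rewrite [X in (_ * X)%E](lebesgue_measure_ball c (ltW e0)) -EFinM lte_fin.
by rewrite mulr_gt0 ?divr_gt0// mulrn_wgt0.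
Qed.

(** Non-negativity holds everywhere, so that mixtures grow pointwise as terms are added. The
    Lipschitz constants are chosen only at the end. *)
Definition smooth_lipschitz_pdf (R : realType) (q : R -> R) : Prop :=
  [/\ smooth q, forall x, 0 <= q x, exists L : R, L.-lipschitz q &
      (\int[@lebesgue_measure R]_x (q x)%:E = 1)%E].

Lemma smooth_continuous (R : realType) (f : R -> R) : smooth f -> continuous f.
Proof. by move/smoothP => /(_ 1%N); exact: derivable_upto_continuous. Qed.

Lemma smooth_measurable (R : realType) (f : R -> R) :
  smooth f -> measurable_fun setT f.
Proof. by move/smooth_continuous; exact: continuous_measurable_fun. Qed.

Lemma smooth_lipschitz_pdf_is_pdf (R : realType) (q : R -> R) :
  smooth_lipschitz_pdf q -> is_pdf (@lebesgue_measure R) q.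
Proof.
move=> [sq q0 _ q1]; split => //.
- move=> Y mY; exists (q @^-1` Y).
    by rewrite -[X in measurable X]setTI; exact: smooth_measurable.
  by exists set0; [exact: negligible_set0|rewrite setU0].
- exact: aeW.
Qed.

Lemma smooth_bump_affine_pdf (R : realType) (a b : R) : 0 < a ->
  exists q : R -> R, smooth_lipschitz_pdf q /\
  exists2 I : R, 0 < I & forall x, smooth_bump (a * x + b) = I * q x.
Proof.
move=> a0; pose f x := smooth_bump (a * x + b).
have Df k : derivable_upto k f.
  exact/derivable_upto_affine/derivable_upto_smooth_bump.
have f0 y : (y < - b / a) || ((2 - b) / a < y) -> f y = 0.
  rewrite /f ltr_pdivlMr// ltr_pdivrMr// => h; apply: smooth_bump_eq0.
  by move: h => /orP[h|h]; apply/orP; [left|right]; lra.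
(* At this point the argument of the bump is 1. *)
have fc : 0 < f ((1 - b) / a).
  rewrite /f (_ : _ + _ = 1) ?smooth_bump_gt0//; field; exact: lt0r_neq0.
have cf : continuous f by exact/derivable_upto_continuous/Df.
have [I I0 fI] := compact_support_integral cf (fun=> smooth_bump_ge0 _) f0 fc.
exists (fun x => I^-1 * f x); split; last first.
  by exists I => // x; rewrite mulrA divff ?mul1r// gt_eqF.
have Dq k : derivable_upto k (fun x => I^-1 * f x).
  by apply: derivable_uptoM => //; exact: derivable_upto_cst.
split.
- exact/smoothP.
- by move=> x; rewrite mulr_ge0 ?smooth_bump_ge0// invr_ge0 ltW.
- apply: (@compact_support_lipschitz _ _ (- b / a) ((2 - b) / a)) => //.
    by rewrite ler_wpM2r ?invr_ge0 ?ltW//; lra.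
  by move=> y /f0 ->; rewrite mulr0.
- under eq_integral do rewrite EFinM.
  rewrite ge0_integralZl//.
  + by rewrite fI -EFinM mulVf// gt_eqF.
  + by apply/measurable_EFinP; exact: continuous_measurable_fun.
  + by move=> x _; rewrite lee_fin smooth_bump_ge0.
  + by rewrite lee_fin invr_ge0 ltW.
Qed.

(** * Finite mixtures of product densities *)

Lemma measurable_prod_coord (R : realType) n (q : 'I_n -> R -> R) :
  (forall j, measurable_fun setT (q j)) ->
  measurable_fun setT (fun x : 'rV[R]_n => \prod_(j < n) q j (x ord0 j)).
Proof.
move=> mq; apply: measurable_prod => j _.
exact: (measurableT_comp (mq j) (measurable_rV_coord j)).
Qed.

(** Induction on the dimension: the measure in dimension n+1 is a pushforward of a product measure,
    so Tonelli's theorem splits off the first coordinate. *)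
Lemma integral_prod_coord (R : realType) n (q : 'I_n -> R -> R) :
  (forall j, measurable_fun setT (q j)) -> (forall j x, 0 <= q j x) ->
  (forall j, \int[@lebesgue_measure R]_x (q j x)%:E = 1)%E ->
  (\int[lebesgue_rV R n]_x (\prod_(j < n) q j (x ord0 j))%:E = 1)%E.
Proof.
elim: n q => [|n IH] q mq q0 q1.
  under eq_integral do rewrite big_ord0.
  by rewrite integral_cst//= diracT mule1.
have mf : measurable_fun setT
    (fun x : 'rV[R]_n.+1 => (\prod_(j < n.+1) q j (x ord0 j))%:E).
  by apply/measurable_EFinP; exact: measurable_prod_coord.
transitivity (\int[pushforward (@lebesgue_measure R \x lebesgue_rV R n)
    (@rV_cons R n)]_x (\prod_(j < n.+1) q j (x ord0 j))%:E)%E.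
  by [].
rewrite ge0_integral_pushforward//; last 2 first.
- exact: measurable_rV_cons.
- by move=> x _; rewrite lee_fin prodr_ge0.
rewrite preimage_setT fubini_tonelli1//=; last 2 first.
- exact: (measurableT_comp mf (@measurable_rV_cons R n)).
- by move=> z; rewrite lee_fin prodr_ge0.
rewrite /fubini_F -(q1 ord0); apply: eq_integral => x _.
under eq_integral => y _.
  rewrite /= big_ord_recl rV_cons0/=.
  under eq_bigr do rewrite rV_consS.
  rewrite EFinM; over.
  rewrite /=.
rewrite ge0_integralZl//.
- by rewrite (IH (fun j => q (lift ord0 j))) ?mule1//.
- by apply/measurable_EFinP; apply: (measurable_prod_coord (fun j => mq (lift ord0 j))).
- by move=> y _; rewrite lee_fin prodr_ge0.
- by rewrite lee_fin.
Qed.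

(** A weight and the marginals; when these are densities the weight is the integral of the term. *)
Definition product_term (R : realType) (d : nat) : Type :=
  (R * ('I_d -> R -> R))%type.

Definition good_term (R : realType) d (t : product_term R d) : Prop :=
  0 <= t.1 /\ forall j, smooth_lipschitz_pdf (t.2 j).

Definition term_fun (R : realType) d (t : product_term R d) (x : 'rV[R]_d) : R :=
  t.1 * \prod_(j < d) t.2 j (x ord0 j).

Definition mixture (R : realType) d (u : seq (product_term R d)) (x : 'rV[R]_d) : R :=
  \sum_(t <- u) term_fun t x.

Definition mass (R : realType) d (u : seq (product_term R d)) : R :=
  \sum_(t <- u) t.1.

(* Indexed by position because terms have no decidable equality, hence no
   membership predicate. *)
Definition good (R : realType) d (u : seq (product_term R d)) : Prop :=
  forall i t0, (i < size u)%N -> good_term (nth t0 u i).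

Lemma good_nil (R : realType) d : good ([::] : seq (product_term R d)).
Proof. by move=> i t0. Qed.

Lemma good_cat (R : realType) d (u v : seq (product_term R d)) :
  good u -> good v -> good (u ++ v).
Proof.
move=> gu gv i t0; rewrite size_cat nth_cat.
case: (ltnP i (size u)) => [iu _|ui]; first exact: gu.
by rewrite -ltn_subLR//; exact: gv.
Qed.

Lemma good_cons (R : realType) d (t : product_term R d) u :
  good (t :: u) -> good_term t /\ good u.
Proof.
move=> gu; split; first exact: (gu 0%N t).
by move=> i t0 iu; exact: (gu i.+1 t0).
Qed.

Lemma term_fun_ge0 (R : realType) d (t : product_term R d) x :
  good_term t -> 0 <= term_fun t x.
Proof.
by move=> [t0 gt]; rewrite mulr_ge0// prodr_ge0// => j _; have [] := gt j.
Qed.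

Lemma measurable_term_fun (R : realType) d (t : product_term R d) :
  good_term t -> measurable_fun setT (term_fun t).
Proof.
move=> [_ gt]; apply: measurable_funM => //; apply: measurable_prod_coord => j.
by have [/smooth_measurable] := gt j.
Qed.

Lemma integral_term_fun (R : realType) d (t : product_term R d) :
  good_term t -> (\int[lebesgue_rV R d]_x (term_fun t x)%:E = t.1%:E)%E.
Proof.
move=> [t0 gt]; rewrite /term_fun; under eq_integral do rewrite EFinM.
rewrite ge0_integralZl//.
- rewrite integral_prod_coord ?mule1//.
  + by move=> j; have [/smooth_measurable] := gt j.
  + by move=> j; have [] := gt j.
  + by move=> j; have [] := gt j.
- apply/measurable_EFinP; apply: measurable_prod_coord => j.
  by have [/smooth_measurable] := gt j.
- by move=> x _; rewrite lee_fin prodr_ge0// => j _; have [] := gt j.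
Qed.

Lemma mixture_cat (R : realType) d (u v : seq (product_term R d)) x :
  mixture (u ++ v) x = mixture u x + mixture v x.
Proof. exact: big_cat. Qed.

Lemma mass_cat (R : realType) d (u v : seq (product_term R d)) :
  mass (u ++ v) = mass u + mass v.
Proof. exact: big_cat. Qed.

Lemma mixture_cons (R : realType) d (t : product_term R d) u :
  mixture (t :: u) = term_fun t \+ mixture u.
Proof. by apply/funext => x; exact: big_cons. Qed.

Lemma mixture_ge0 (R : realType) d (u : seq (product_term R d)) x :
  good u -> 0 <= mixture u x.
Proof.
elim: u => [|t u IH]; first by rewrite /mixture big_nil.
by move=> /good_cons[gt gu]; rewrite mixture_cons addr_ge0 ?IH// term_fun_ge0.
Qed.

Lemma measurable_mixture (R : realType) d (u : seq (product_term R d)) :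
  good u -> measurable_fun setT (mixture u).
Proof.
elim: u => [_|t u IH /good_cons[gt gu]].
  rewrite (_ : mixture _ = cst 0)//.
  by apply/funext => x; exact: big_nil.
rewrite mixture_cons; apply: measurable_funD; last exact: IH.
exact: measurable_term_fun.
Qed.

Lemma integral_mixture (R : realType) d (u : seq (product_term R d)) :
  good u -> (\int[lebesgue_rV R d]_x (mixture u x)%:E = (mass u)%:E)%E.
Proof.
elim: u => [_|t u IH /good_cons[gt gu]].
  by rewrite /mixture /mass big_nil integral0_eq// => x _; rewrite big_nil.
rewrite mixture_cons; under eq_integral do rewrite EFinD.
rewrite ge0_integralD//.
- by rewrite IH// integral_term_fun// -EFinD /mass big_cons.
- by move=> x _; rewrite lee_fin term_fun_ge0.
- by apply/measurable_EFinP; exact: measurable_term_fun.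
- by move=> x _; rewrite lee_fin mixture_ge0.
- by apply/measurable_EFinP; exact: measurable_mixture.
Qed.

(** * Continuity of mixtures and approximation from below on a grid *)

Lemma continuous_prod_coord (R : realType) d (q : 'I_d -> R -> R) (s : seq 'I_d) :
  (forall j, continuous (q j)) ->
  continuous (fun x : 'rV[R]_d => \prod_(j <- s) q j (x ord0 j)).
Proof.
move=> cq; elim: s => [|j s IH].
  under eq_fun do rewrite big_nil; exact: cst_continuous.
under eq_fun do rewrite big_cons.
move=> x; apply: continuousM; last exact: IH.
apply: (@continuous_comp _ _ _ (fun x : 'rV[R]_d => x ord0 j) (q j)) => //.
  exact: coord_continuous.
exact: cq.
Qed.

Lemma continuous_mixture (R : realType) d (u : seq (product_term R d)) :
  good u -> continuous (mixture u).
Proof.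
elim: u => [_|t u IH /good_cons[gt gu]].
  rewrite (_ : mixture _ = cst 0); last by apply/funext => x; exact: big_nil.
  exact: cst_continuous.
rewrite mixture_cons => x; apply: continuousD; last exact: IH.
apply: continuousM; first exact: cst_continuous.
apply: continuous_prod_coord => j.
by have [_ /(_ j)[/smooth_continuous]] := gt.
Qed.

(* With [z < grid_size a], the points [(z - a^2) / a] cover [-a, a) with mesh
   [1 / a]: mesh and range are governed by the same parameter. *)
Definition grid_bump (R : realType) (a z : nat) (x : R) : R :=
  smooth_bump (a%:R * x + (a%:R ^+ 2 - z%:R)).

Definition grid_size (a : nat) : nat := (2 * a ^ 2)%N.

Lemma sum_grid_bump_itv (R : realType) (a : nat) (x : R) :
  0 <= \sum_(z < grid_size a) grid_bump a z x <= 1.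
Proof.
apply/andP; split; first by apply: sumr_ge0 => z _; exact: smooth_bump_ge0.
rewrite /grid_bump; under eq_bigr do rewrite addrA.
rewrite sum_smooth_bump.
set y := a%:R * x + _; have /andP[_ h1] := smooth_step_itv y.
have /andP[h2 _] := smooth_step_itv (y - (grid_size a)%:R); lra.
Qed.

(** The grid of parameter n+1 exceeds [-n, n] by 1 on each side, so in the telescoped sum the first
    step has reached 1 and the last is still 0. *)
Lemma sum_grid_bump_eq1 (R : realType) (n : nat) (x : R) :
  `|x| <= n%:R -> \sum_(z < grid_size n.+1) grid_bump n.+1 z x = 1.
Proof.
rewrite ler_norml => /andP[xn nx].
rewrite /grid_bump; under eq_bigr do rewrite addrA.
rewrite sum_smooth_bump smooth_step_ge1 ?smooth_step_le0 ?subr0//.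
- rewrite /grid_size natrM natrX -natr1.
  have := ler0n R n; nra.
- rewrite -natr1; have := ler0n R n; nra.
Qed.

(** At both points the argument of the bump lies in (0, 2), and it is affine of slope a. *)
Lemma grid_bump_dist (R : realType) (a z : nat) (x y : R) : (0 < a)%N ->
  grid_bump a z x != 0 -> grid_bump a z y != 0 -> `|x - y| < 2 / a%:R.
Proof.
move=> a0; have aR : 0 < a%:R :> R by rewrite ltr0n.
have supp (t : R) : smooth_bump t != 0 -> 0 < t < 2.
  by move=> h; rewrite !ltNge -negb_or; apply: contra h => h; rewrite smooth_bump_eq0.
move=> /supp/andP[h1 h2] /supp/andP[h3 h4].
rewrite ltr_pdivlMr// -[X in _ * X]gtr0_norm// -normrM ltr_norml.
by apply/andP; split; lra.
Qed.

(** Cells are indexed by finite functions, the index set that arises when a product of sums over the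
    coordinates is expanded. *)
Definition cell_bump (R : realType) d (a : nat)
    (z : {ffun 'I_d -> 'I_(grid_size a)}) (x : 'rV[R]_d) : R :=
  \prod_(j < d) grid_bump a (z j) (x ord0 j).

Lemma cell_bump_ge0 (R : realType) d a (z : {ffun 'I_d -> 'I_(grid_size a)})
  (x : 'rV[R]_d) : 0 <= cell_bump z x.
Proof. by apply: prodr_ge0 => j _; exact: smooth_bump_ge0. Qed.

Lemma sum_cell_bump (R : realType) d a (x : 'rV[R]_d) :
  \sum_(z : {ffun 'I_d -> 'I_(grid_size a)}) cell_bump z x =
  \prod_(j < d) \sum_(m < grid_size a) grid_bump a m (x ord0 j).
Proof. by rewrite bigA_distr_bigA. Qed.

(** Makes the set under the infimum in [cell_inf] non-empty; the witness puts the argument of every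
    factor at 1. *)
Lemma cell_bump_neq0 (R : realType) d a (z : {ffun 'I_d -> 'I_(grid_size a)}) :
  (0 < a)%N -> exists x : 'rV[R]_d, cell_bump z x != 0.
Proof.
move=> a0; have aR : a%:R != 0 :> R by rewrite pnatr_eq0 -lt0n.
exists (\row_j ((1 - (a%:R ^+ 2 - (z j)%:R)) / a%:R)).
apply/prodf_neq0 => j _; rewrite mxE /grid_bump.
rewrite (_ : _ + _ = 1) ?gt_eqF ?smooth_bump_gt0//; field; exact: aR.
Qed.

Definition cell_inf (R : realType) d (f : 'rV[R]_d -> R) a
    (z : {ffun 'I_d -> 'I_(grid_size a)}) : R :=
  inf [set f x | x in [set x | cell_bump z x != 0]].

Lemma cell_inf_le (R : realType) d (f : 'rV[R]_d -> R) a
    (z : {ffun 'I_d -> 'I_(grid_size a)}) x :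
  (forall x, 0 <= f x) -> cell_bump z x != 0 -> cell_inf f z <= f x.
Proof.
move=> f0 zx; apply: ge_inf; last by exists x.
by exists 0 => _ [y _ <-].
Qed.

Lemma cell_inf_ge (R : realType) d (f : 'rV[R]_d -> R) a
    (z : {ffun 'I_d -> 'I_(grid_size a)}) c : (0 < a)%N ->
  (forall x, cell_bump z x != 0 -> c <= f x) -> c <= cell_inf f z.
Proof.
move=> a0 cf; apply: lb_le_inf.
  by have [x xz] := @cell_bump_neq0 R d a z a0; exists (f x); exists x.
by move=> _ [y /= yz <-]; exact: cf.
Qed.

(** The normalizing constants of the one-dimensional bumps are absorbed into the weight. *)
Lemma cell_term (R : realType) d (c : R) a
    (z : {ffun 'I_d -> 'I_(grid_size a)}) : (0 < a)%N -> 0 <= c ->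
  exists t : product_term R d,
    good_term t /\ forall x, term_fun t x = c * cell_bump z x.
Proof.
move=> a0 c0; have aR : 0 < a%:R :> R by rewrite ltr0n.
have H j := smooth_bump_affine_pdf (a%:R ^+ 2 - (z j)%:R) aR.
have [q Hq] := choice H.
have qI j : exists I : R, 0 < I /\
    forall x, smooth_bump (a%:R * x + (a%:R ^+ 2 - (z j)%:R)) = I * q j x.
  by have [_ [I]] := Hq j; exists I.
have [I HI] := choice qI.
exists (c * \prod_j I j, q); split.
  split; last by move=> j; have [] := Hq j.
  by rewrite mulr_ge0// prodr_ge0// => j _; apply: ltW; have [] := HI j.
move=> x; rewrite /term_fun/= -mulrA -big_split/=; congr (_ * _).
by apply: eq_bigr => j _; rewrite /grid_bump (HI j).2.
Qed.

Lemma level_approx (R : realType) d (f : 'rV[R]_d -> R) a :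
  (0 < a)%N -> (forall x, 0 <= f x) ->
  exists u : seq (product_term R d), good u /\
    forall x, mixture u x =
      \sum_(z : {ffun 'I_d -> 'I_(grid_size a)}) cell_inf f z * cell_bump z x.
Proof.
move=> a0 f0.
have fz (z : {ffun 'I_d -> 'I_(grid_size a)}) := @cell_term R d (cell_inf f z)
  a z a0 (@cell_inf_ge R d f a z 0 a0 (fun x _ => f0 x)).
have [t Ht] := choice fz.
exists [seq t z | z <- enum {ffun 'I_d -> 'I_(grid_size a)}]; split.
  move=> i t0; rewrite size_map => iu.
  have [z0 _] : exists z0 : {ffun 'I_d -> 'I_(grid_size a)}, true.
    by move: iu; case: (enum _) => // z0 ? _; exists z0.
  rewrite (nth_map z0)//.
  by have [] := Ht (nth z0 (enum {ffun 'I_d -> 'I_(grid_size a)}) i).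
move=> x; rewrite /mixture big_map big_enum/=.
by apply: eq_bigr => z _; have [_] := Ht z.
Qed.

Lemma mixture_approx (R : realType) d (f : 'rV[R]_d -> R) :
  (forall x, 0 <= f x) ->
  exists u : nat -> seq (product_term R d),
    [/\ forall n, good (u n), forall n x, mixture (u n) x <= f x &
        forall x, {for x, continuous f} -> mixture (u n) x @[n --> \oo] --> f x].
Proof.
move=> f0.
have [u Hu] := choice (fun n => @level_approx R d f n.+1 isT f0).
have uf n x : mixture (u n) x <= f x.
  have [_ ->] := Hu n.
  (* A bump that is non-zero at x carries an infimum at most f(x), and the bumps sum to at most
     1. *)
  apply: (@le_trans _ _ (f x *
      \sum_(z : {ffun 'I_d -> 'I_(grid_size n.+1)}) cell_bump z x)).
    rewrite mulr_sumr; apply: ler_sum => z _.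
    have [->|zx] := eqVneq (cell_bump z x) 0; first by rewrite !mulr0.
    by rewrite ler_wpM2r ?cell_bump_ge0// cell_inf_le.
  rewrite ler_piMr// sum_cell_bump; apply: prodr_ile1 => j _.
  exact: sum_grid_bump_itv.
exists u; split => // [n|x cfx]; first by have [] := Hu n.
apply/cvgrPdist_le => e e0.
have /cvgrPdist_le /(_ e e0) /nbhs_ballP[r /= r0 Hr] := cfx.
near=> n.
rewrite ger0_norm ?subr_ge0// lerBlDr -lerBlDl.
have xn j : `|x ord0 j| <= n%:R.
  apply: (@le_trans _ _ `|x|).
    by rewrite [leRHS]mx_normE -[leLHS]nngE num_le (le_bigmax _ _ (ord0, j)).
  by near: n; exact: nbhs_infty_ger.
have [_ ->] := Hu n.
(* For large n the bumps sum to 1 at x, so f(x) - e can be spread over the cells and compared with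
   each infimum separately. *)
rewrite -[leLHS]mulr1.
have <- : \sum_(z : {ffun 'I_d -> 'I_(grid_size n.+1)}) cell_bump z x = 1.
  by rewrite sum_cell_bump big1// => j _; exact: sum_grid_bump_eq1.
rewrite mulr_sumr; apply: ler_sum => z _.
have [->|zx] := eqVneq (cell_bump z x) 0; first by rewrite !mulr0.
rewrite ler_wpM2r ?cell_bump_ge0//; apply: cell_inf_ge => // y zy.
suff : `|f x - f y| <= e by move=> h; have := ler_norm (f x - f y); lra.
(* Balls of row vectors are coordinatewise, and two points where the same cell bump is non-zero
   differ by less than 2/(n+1) in each coordinate. *)
apply: Hr; split=> // i j /=.
rewrite (ord1 i).
apply: (@lt_le_trans _ _ (2 / n.+1%:R)).
  apply: (@grid_bump_dist _ _ (z j)) => //.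
    by move/prodf_neq0 : zx; exact.
  by move/prodf_neq0 : zy; exact.
rewrite ler_pdivrMr// -ler_pdivrMl// (@le_trans _ _ n%:R) ?ler_nat//.
by near: n; exact: nbhs_infty_ger.
Unshelve. all: by end_near. Qed.

(** * Exhausting the mass of an almost everywhere continuous density *)

Import HBNNSimple.

(* [f] and [g] need not be measurable: the integral is a supremum over simple
   functions, and each of these can be cut off on [N]. This is needed because
   the density of the theorem is only Lebesgue measurable. *)
Lemma ge0_integral_le_off_null (R : realType) d (T : measurableType d)
    (mu : {measure set T -> \bar R}) (N : set T) (f g : T -> \bar R) :
  measurable N -> mu N = 0%E -> (forall x, 0 <= f x)%E ->
  (forall x, 0 <= g x)%E -> (forall x, ~ N x -> f x <= g x)%E ->
  (\int[mu]_x f x <= \int[mu]_x g x)%E.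
Proof.
move=> mN N0 f0 g0 fg; rewrite !ge0_integralTE//.
apply: ge_ereal_sup => _ [h /= hf <-].
have mC : measurable (~` N) by exact: measurableC.
apply: ereal_sup_ubound; exists (proj_nnsfun h mC) => /=.
  move=> x; rewrite mindicE; have [|/negP xN] := boolP (x \in ~` N).
    by rewrite inE mulr1 => /fg; exact: le_trans.
  by rewrite mulr0.
rewrite -!integralT_nnsfun; apply: ge0_ae_eq_integral => //.
- exact/measurable_EFinP.
- exact/measurable_EFinP.
- by move=> x _; rewrite lee_fin.
- by move=> x _; rewrite lee_fin.
exists N; split => // x /=; apply: contra_notP => xN _.
by rewrite mindicE mem_set ?mulr1.
Qed.

Lemma eq_integral_off_null (R : realType) d (T : measurableType d)
    (mu : {measure set T -> \bar R}) (N : set T) (f g : T -> \bar R) :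
  measurable N -> mu N = 0%E -> (forall x, 0 <= f x)%E ->
  (forall x, 0 <= g x)%E -> (forall x, ~ N x -> f x = g x) ->
  (\int[mu]_x f x = \int[mu]_x g x)%E.
Proof.
move=> mN N0 f0 g0 fg; apply/eqP; rewrite eq_le.
by rewrite !(@ge0_integral_le_off_null _ _ _ _ N)//; move=> x /fg ->.
Qed.

(** The integral of p is that of its positive part, max(p, 0), minus that of its negative part,
    which vanishes off [N]. *)
Lemma integral_max0 (R : realType) d (T : measurableType d)
    (mu : {measure set T -> \bar R}) (N : set T) (p : T -> R) :
  measurable N -> mu N = 0%E -> (forall x, ~ N x -> 0 <= p x) ->
  (\int[mu]_x (Num.max (p x) 0)%:E = \int[mu]_x (p x)%:E)%E.
Proof.
move=> mN N0 p0; rewrite [RHS]integralE.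
rewrite [X in (_ = _ - X)%E](_ : _ = 0%E); last first.
  rewrite -(integral0 mu setT); apply: (@eq_integral_off_null _ _ _ _ N) => //.
  by move=> x /p0 px; rewrite /= funenegE; apply/max_idPr;
    rewrite -EFinN lee_fin oppr_le0.
by rewrite sube0; apply: eq_integral => x _; rewrite funeposE EFin_max.
Qed.

(** The grid approximation is applied to the remainder f - u. In the dominated convergence, f cut
    off on [N] is both the limit and the dominating function, since it is Borel measurable. *)
Lemma mixture_approx_mass (R : realType) d (N : set 'rV[R]_d)
    (f : 'rV[R]_d -> R) (u : seq (product_term R d)) (e : R) :
  measurable N -> lebesgue_rV R d N = 0%E ->
  (forall x, 0 <= f x) -> (forall x, ~ N x -> {for x, continuous f}) ->
  (\int[lebesgue_rV R d]_x (f x)%:E = 1)%E ->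
  measurable_fun setT (fun x => f x * \1_(~` N) x) ->
  good u -> (forall x, mixture u x <= f x) -> 0 < e ->
  exists v, [/\ good v, forall x, mixture (u ++ v) x <= f x &
                1 - e <= mass (u ++ v)].
Proof.
move=> mN N0 f0 cf intf mf gu uf e0.
have fu0 x : 0 <= f x - mixture u x by rewrite subr_ge0.
have [v [gv vle vcvg]] := mixture_approx fu0.
have guv n : good (u ++ v n) by exact: good_cat.
have uvle n x : mixture (u ++ v n) x <= f x.
  by rewrite mixture_cat addrC -lerBrDr.
have intg : (\int[lebesgue_rV R d]_x (f x * \1_(~` N) x)%:E = 1)%E.
  rewrite -intf; apply: (@eq_integral_off_null _ _ _ _ N) => //.
  - by move=> x; rewrite lee_fin mulr_ge0.
  - by move=> x xN; rewrite indicE mem_set// mulr1.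
have mg : measurable_fun setT (fun x => (f x * \1_(~` N) x)%:E).
  exact/measurable_EFinP.
have [] := @dominated_convergence _ _ R (lebesgue_rV R d) setT measurableT
  (fun n x => (mixture (u ++ v n) x)%:E)
  (fun x => (f x * \1_(~` N) x)%:E) (fun x => (f x * \1_(~` N) x)%:E).
- by move=> n; apply/measurable_EFinP; exact: measurable_mixture.
- exact: mg.
- exists N; split => // x /=; apply: contra_notP => xN _.
  rewrite indicE mem_set// mulr1; apply: cvg_EFin; first exact: nearW.
  rewrite (_ : _ \o _ = (fun n => mixture u x + mixture (v n) x)); last first.
    by apply/funext => n /=; rewrite mixture_cat.
  rewrite -[X in _ --> X](subrKC (mixture u x)).
  apply: cvgD; first exact: cvg_cst.
  apply: vcvg; apply: continuousB; first exact: cf.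
  exact: continuous_mixture.
- apply/integrableP; split; first exact: mg.
  under eq_integral do rewrite gee0_abs ?lee_fin ?mulr_ge0//.
  by rewrite intg ltry.
- exists N; split => // x /=; apply: contra_notP => xN n _.
  rewrite indicE mem_set// mulr1 lee_fin ger0_norm//; exact: mixture_ge0.
move=> _ _; rewrite intg.
rewrite (_ : (fun n => _) = (fun n => (mass (u ++ v n))%:E)); last first.
  by apply/funext => n; exact: integral_mixture.
move=> /fine_cvgP[_ /cvgrPdist_le /(_ e e0) [n _ /(_ n (leqnn n))]] /= h.
exists (v n); split=> //; have := ler_norm (1 - mass (u ++ v n)); lra.
Qed.

(** The cut-off of f is everywhere the limit of the cut-off grid mixtures, which are measurable. *)
Lemma measurable_off_null (R : realType) d (N : set 'rV[R]_d)
    (f : 'rV[R]_d -> R) :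
  measurable N -> (forall x, 0 <= f x) ->
  (forall x, ~ N x -> {for x, continuous f}) ->
  measurable_fun setT (fun x => f x * \1_(~` N) x).
Proof.
move=> mN f0 cf; have [v [gv _ vcvg]] := mixture_approx f0.
apply/measurable_EFinP.
apply: (@emeasurable_fun_cvg _ _ _ setT
  (fun n x => (mixture (v n) x * \1_(~` N) x)%:E)) => [n|x _].
  apply/measurable_EFinP; apply: measurable_funM.
    exact: measurable_mixture.
  by apply: measurable_indic; exact: measurableC.
apply: cvg_EFin; first exact: nearW.
rewrite indicE; have [|_] := boolP (x \in _).
  rewrite inE => xN; apply: cvgM; last exact: cvg_cst.
  exact/vcvg/cf.
rewrite mulr0 (_ : _ \o _ = cst 0); first exact: cvg_cst.
by apply/funext => n /=; rewrite mulr0.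
Qed.

Lemma mixture_exhaustion (R : realType) d (N : set 'rV[R]_d)
    (f : 'rV[R]_d -> R) :
  measurable N -> lebesgue_rV R d N = 0%E ->
  (forall x, 0 <= f x) -> (forall x, ~ N x -> {for x, continuous f}) ->
  (\int[lebesgue_rV R d]_x (f x)%:E = 1)%E ->
  exists t : nat -> seq (product_term R d),
    [/\ forall n, good (t n),
        (fun n => \sum_(k < n) mass (t k)) @ \oo --> (1 : R) &
        {ae lebesgue_rV R d, forall x,
          (fun n => \sum_(k < n) mixture (t k) x) @ \oo --> f x}].
Proof.
move=> mN N0 f0 cf intf.
have mf := measurable_off_null mN f0 cf.
pose P (u : seq (product_term R d)) := good u /\ forall x, mixture u x <= f x.
(* The pair holds the stage and the list built so far. The invariant [P] is a premise inside the
   existential, so that choice yields a total function. *)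
have step (nu : nat * seq (product_term R d)) : exists v : seq (product_term R d),
    P nu.2 -> [/\ good v, P (nu.2 ++ v) & 1 - nu.1.+1%:R^-1 <= mass (nu.2 ++ v)].
  have [[gu ule]|nP] := pselect (P nu.2); last by exists [::].
  have e0 : 0 < (nu.1.+1%:R^-1 : R) by rewrite invr_gt0.
  have [v [gv vle mv]] := mixture_approx_mass mN N0 f0 cf intf mf gu ule e0.
  by exists v => _; split => //; split => //; exact: good_cat.
have [F HF] := choice step.
(* [U n] accumulates the blocks [t k] for k < n; its mass is within 1/n of 1 for n > 0. *)
pose U := fix U n := if n is n'.+1 then U n' ++ F (n', U n') else [::].
have PU n : P (U n).
  elim: n => [|n IH] /=; last by have [] := HF (n, U n) IH.
  by split; [exact: good_nil|move=> x; rewrite /mixture big_nil].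
pose t n := F (n, U n).
have gt n : good (t n) by have [] := HF (n, U n) (PU n).
have massU n : mass (U n) = \sum_(k < n) mass (t k).
  elim: n => [|n IH]; first by rewrite big_ord0 /mass big_nil.
  by rewrite big_ord_recr /= mass_cat IH.
have mixU n x : mixture (U n) x = \sum_(k < n) mixture (t k) x.
  elim: n => [|n IH]; first by rewrite big_ord0 /mixture big_nil.
  by rewrite big_ord_recr /= mixture_cat IH.
have gU n : good (U n) by have [] := PU n.
have Ule n x : mixture (U n) x <= f x by have [_] := PU n.
(* Cutting off on [N] makes the bound f' measurable while keeping g_n <= f' everywhere. *)
pose g n x := mixture (U n) x * \1_(~` N) x.
pose f' x := f x * \1_(~` N) x.
have mC : measurable (~` N) by exact: measurableC.
have mg n : measurable_fun setT (g n).
  by apply: measurable_funM; [exact: measurable_mixture|exact: measurable_indic].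
have g0 n x : 0 <= g n x by apply: mulr_ge0 => //; exact: mixture_ge0.
have intf' : (\int[lebesgue_rV R d]_x (f' x)%:E = 1)%E.
  rewrite -intf; apply: (@eq_integral_off_null _ _ _ _ N) => //.
  - by move=> x; rewrite lee_fin mulr_ge0.
  - by move=> x xN; rewrite /f' indicE mem_set// mulr1.
have intg n : (\int[lebesgue_rV R d]_x (g n x)%:E = (mass (U n))%:E)%E.
  rewrite -integral_mixture//; apply: (@eq_integral_off_null _ _ _ _ N) => //.
  - by move=> x; rewrite lee_fin.
  - by move=> x; rewrite lee_fin mixture_ge0.
  - by move=> x xN; rewrite /g indicE mem_set// mulr1.
have gf' n x : g n x <= f' x by rewrite /g /f' ler_wpM2r.
have mass_le1 n : mass (U n) <= 1.
  rewrite -lee_fin -intg -intf'; apply: ge0_le_integral => //.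
  - by move=> x _; rewrite lee_fin.
  - exact/measurable_EFinP.
  - exact/measurable_EFinP.
  - by move=> x _; rewrite lee_fin.
have mass_cvg : mass (U n) @[n --> \oo] --> (1 : R).
  (* Stage n controls the mass of [U n.+1], whence the shift; [harmonic n] is 1/(n+1). *)
  rewrite -(cvg_shiftS (fun n => mass (U n))).
  apply: (@squeeze_cvgr _ _ _ _ (fun n => 1 - harmonic n) (fun=> 1)).
  - near=> n; rewrite mass_le1 andbT.
    by have [] := HF (n, U n) (PU n).
  - rewrite -[X in _ --> X]subr0; apply: cvgB; first exact: cvg_cst.
    exact: cvg_harmonic.
  - exact: cvg_cst.
have nd x : nondecreasing_seq (g ^~ x).
  apply/nondecreasing_seqP => n; rewrite /g ler_wpM2r//= mixture_cat lerDl.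
  by apply: mixture_ge0; have [] := HF (n, U n) (PU n).
have cg x : cvgn (g ^~ x).
  apply: nondecreasing_is_cvgn => //.
  by exists (f' x) => _ [n _ <-].
pose G x := limn (g ^~ x).
have gG n x : g n x <= G x by exact: nondecreasing_cvgn_le.
have Gf' x : G x <= f' x by apply: limr_le => //; exact: nearW.
have mG : measurable_fun setT (fun x => (G x)%:E).
  apply: (@emeasurable_fun_cvg _ _ _ setT (fun n x => (g n x)%:E)) => [n|x _].
    exact/measurable_EFinP.
  by apply: cvg_EFin; [exact: nearW|exact: cg].
have mh : measurable_fun setT (fun x => (f' x - G x)%:E).
  by apply/measurable_EFinP; apply: measurable_funB => //; exact/measurable_EFinP.
have h0 x : (0 <= (f' x - G x)%:E)%E by rewrite lee_fin subr_ge0.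
have G0 x : (0 <= (G x)%:E)%E by rewrite lee_fin (le_trans (g0 0%N x)).
(* Each mass is the integral of some g_n <= G, and the masses tend to 1. *)
have intG : (1 <= \int[lebesgue_rV R d]_x (G x)%:E)%E.
  have massG n : ((mass (U n))%:E <= \int[lebesgue_rV R d]_x (G x)%:E)%E.
    rewrite -intg; apply: ge0_le_integral => //.
    - by move=> x _; rewrite lee_fin.
    - exact/measurable_EFinP.
    - by move=> x _; rewrite lee_fin.
  have mass_ecvg : (mass (U n))%:E @[n --> \oo] --> (1%:E : \bar R).
    by apply: cvg_EFin => //; exact: nearW.
  rewrite -(cvg_lim _ mass_ecvg)//; apply: lime_le; first by apply/cvg_ex; exists 1%:E.
  exact: nearW.
have inth : (\int[lebesgue_rV R d]_x (f' x - G x)%:E = 0)%E.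
  have E : (\int[lebesgue_rV R d]_x (f' x)%:E =
      \int[lebesgue_rV R d]_x (f' x - G x)%:E + \int[lebesgue_rV R d]_x (G x)%:E)%E.
    rewrite -ge0_integralD//.
    by apply: eq_integral => x _; rewrite -EFinD subrK.
  have i0 : (0 <= \int[lebesgue_rV R d]_x (f' x - G x)%:E)%E by exact: integral_ge0.
  (* Two non-negative extended reals sum to 1 and the second is at least 1: both are finite and the
     first is 0. *)
  move: E intG i0; rewrite intf'.
  case: (\int[lebesgue_rV R d]_x (f' x - G x)%:E)%E => [a| |];
    case: (\int[lebesgue_rV R d]_x (G x)%:E)%E => [b| |] //=.
  rewrite -EFinD => -[ab]; rewrite !lee_fin => b1 a0.
  by congr EFin; lra.
have /ae_eq_integral_abs : (\int[lebesgue_rV R d]_x `|(f' x - G x)%:E| = 0)%E.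
  by rewrite -inth; apply: eq_integral => x _; rewrite gee0_abs.
move=> /(_ measurableT mh) hae.
exists t; split => //.
  by under eq_fun do rewrite -massU.
have Nae : {ae lebesgue_rV R d, forall x, ~ N x}.
  by exists N; split => // x /=; rewrite notK.
apply: filterS2 hae Nae => x /(_ I) /= [fG] xN.
under eq_fun do rewrite -mixU.
have f'E : f' x = f x by rewrite /f' indicE mem_set// mulr1.
have -> : (fun n => mixture (U n) x) = g ^~ x.
  by apply/funext => n; rewrite /g indicE mem_set// mulr1.
rewrite -f'E (_ : f' x = G x); first exact: cg.
by apply/eqP; rewrite -subr_eq0; apply/eqP.
Unshelve. all: by end_near. Qed.

(** * Enumerating the terms as a single series *)

(** Non-negative series are unordered sums, which may be regrouped and reindexed along a
    bijection. *)
Lemma nneseries_enum (R : realType) (a : nat -> nat -> \bar R)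
    (e : nat -> nat * nat) :
  set_bij [set: nat] [set: nat * nat] e -> (forall n m, 0 <= a n m)%E ->
  (\sum_(i <oo) a (e i).1 (e i).2 = \sum_(n <oo) \sum_(m <oo) a n m)%E.
Proof.
move=> be a0; rewrite !nneseries_esumT//; last by move=> n; exact: nneseries_ge0.
under [RHS]eq_esum do rewrite nneseries_esumT//.
rewrite esum_esum// (reindex_esum [set: nat] _ e)//.
rewrite (_ : _ `*`` _ = setT)//.
by apply/seteqP; split.
Qed.

(** Past the end of the list [nth] returns [x0], which contributes 0, so the partial sums are
    eventually constant. *)
Lemma nneseries_nth (R : realType) (T : Type) (x0 : T) (F : T -> R) (s : seq T) :
  F x0 = 0 ->
  (\sum_(m <oo) (F (nth x0 s m))%:E = (\sum_(y <- s) F y)%:E)%E.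
Proof.
move=> F0; apply: lim_near_cst => //; near=> k.
have sk : (size s <= k)%N by near: k; exact: nbhs_infty_ge.
rewrite sumEFin (big_cat_nat _ sk)//= [X in _ + X]big1_seq ?addr0.
  by rewrite (big_nth x0).
by move=> i /andP[_]; rewrite mem_index_iota => /andP[si _]; rewrite nth_default.
Unshelve. all: by end_near. Qed.

Lemma series_cvg_nneseries (R : realType) (a : nat -> R) (l : R) :
  (forall i, 0 <= a i) ->
  series a @ \oo --> l <-> (\sum_(i <oo) (a i)%:E = l%:E)%E.
Proof.
move=> a0.
have aE : (fun n => (\sum_(0 <= i < n) (a i)%:E)%E) = EFin \o series a.
  by apply/funext => n; rewrite /= /series/= sumEFin.
split=> [al|al].
  apply/cvg_lim => //; rewrite aE; apply: cvg_EFin => //; exact: nearW.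
have : (\sum_(0 <= i < n) (a i)%:E)%E @[n --> \oo] --> l%:E.
  by rewrite -al; apply: is_cvg_nneseries => i _ _; rewrite lee_fin.
by rewrite aE => /fine_cvgP[].
Qed.

(** Stated for a general F because it serves both the weights and the values of the terms at a
    point. *)
Lemma series_enum (R : realType) (T : Type) (x0 : T) (F : T -> R)
    (t : nat -> seq T) (e : nat -> nat * nat) (l : R) :
  set_bij [set: nat] [set: nat * nat] e -> F x0 = 0 ->
  (forall n m, 0 <= F (nth x0 (t n) m)) ->
  (fun n => \sum_(k < n) \sum_(y <- t k) F y) @ \oo --> l ->
  series (fun i => F (nth x0 (t (e i).1) (e i).2)) @ \oo --> l.
Proof.
move=> be F0 Fge0 tl; apply/series_cvg_nneseries => //.
rewrite (@nneseries_enum _ (fun n m => (F (nth x0 (t n) m))%:E) e)//.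
under eq_eseriesr do rewrite nneseries_nth//.
apply/series_cvg_nneseries.
  move=> n; rewrite (big_nth x0) sumr_ge0//.
rewrite (_ : series _ = (fun n => \sum_(k < n) \sum_(y <- t k) F y))//.
by apply/funext => n; rewrite /series/= big_mkord.
Qed.

(** Precompose with the transposition of 0 and k. This serves to bring a positive weight to the
    first position. *)
Lemma nat2_enum_at (k : nat) (e : nat -> nat * nat) :
  set_bij [set: nat] [set: nat * nat] e ->
  exists2 e' : nat -> nat * nat, set_bij [set: nat] [set: nat * nat] e' & e' 0%N = e k.
Proof.
move=> be; pose s i := if i == 0%N then k else if i == k then 0%N else i.
have sK : involutive s.
  move=> i; rewrite /s; have [->|i0] := eqVneq i 0%N.
    by rewrite eqxx; case: ifP => [/eqP|].
  have [->|ik] := eqVneq i k; first by rewrite eqxx.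
  by rewrite (negbTE i0) (negbTE ik).
exists (e \o s) => //; apply: (set_bij_comp _ be).
split=> //; first by move=> i j _ _ /(congr1 s); rewrite !sK.
by move=> i _; exists (s i).
Qed.

Theorem theorem2 (R : realType) (d : nat) (p : 'rV[R]_d -> R)
    (d_gt0 : (0 < d)%N)
    (p_pdf : is_pdf (lebesgue_rV R d) p)
    (p_cont : {ae lebesgue_rV R d, forall x, {for x, continuous p}}) :
  exists w L : R^nat, has_smooth_NL_spectrum p w L.
Proof.
have [_ p_ge0 p_int] := p_pdf.
have [N [mN N0 subN]] : {ae lebesgue_rV R d, forall x,
    0 <= p x /\ {for x, continuous p}}.
  by apply: filterS2 p_ge0 p_cont => x; split.
have notN x : ~ N x -> 0 <= p x /\ {for x, continuous p}.
  by move=> xN; apply: contrapT => h; apply/xN/subN.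
pose f x := Num.max (p x) 0.
have f0 x : 0 <= f x by rewrite le_max lexx orbT.
have cf x : ~ N x -> {for x, continuous f}.
  move=> /notN[_ cp]; apply: continuous_max => //; exact: cst_continuous.
have intf : (\int[lebesgue_rV R d]_x (f x)%:E = 1)%E.
  by rewrite (@integral_max0 _ _ _ _ N)// => x /notN[].
have [t [gt mass_t mix_t]] := mixture_exhaustion mN N0 f0 cf intf.
(* Padding terms have weight 0, but their marginals must still be smooth Lipschitz densities; any
   such density will do. *)
have [q0 [q0_pdf _]] := @smooth_bump_affine_pdf R 1 0 ltr01.
pose t0 : product_term R d := (0, fun=> q0).
have good_nth n m : good_term (nth t0 (t n) m).
  have [mt|tm] := ltnP m (size (t n)); first exact: gt.
  by rewrite nth_default.
have [e0 e0_bij] : exists e : nat -> nat * nat, set_bij [set: nat] [set: nat * nat] e.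
  apply/card_set_bijP; rewrite card_eq_sym; exact: card_nat2.
have mass_enum e : set_bij [set: nat] [set: nat * nat] e ->
    series (fun i => (nth t0 (t (e i).1) (e i).2).1) @ \oo --> (1 : R).
  move=> be; apply: (@series_enum _ _ t0 fst t) => // n m.
  by have [] := good_nth n m.
(* The weights sum to 1, so they cannot all be 0. *)
have [k wk] : exists k, 0 < (nth t0 (t (e0 k).1) (e0 k).2).1.
  apply: contrapT => /forallNP h.
  have w0 i : (nth t0 (t (e0 i).1) (e0 i).2).1 = 0.
    apply/eqP; rewrite eq_le (proj1 (good_nth _ _)) andbT leNgt.
    exact/negP/h.
  have := mass_enum e0 e0_bij.
  rewrite (_ : series _ = cst 0); last first.
    by apply/funext => n; rewrite /series/= big1.
  move=> /(cvg_unique _ (cvg_cst 0)) => /(_ (@Rhausdorff R)) /eqP.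
  by rewrite eq_sym oner_eq0.
have [e e_bij e_0] := nat2_enum_at k e0_bij.
pose tt i := nth t0 (t (e i).1) (e i).2.
have good_tt i : good_term (tt i) by exact: good_nth.
have lip i : exists L : R, forall j, L.-lipschitz ((tt i).2 j).
  have [_ gi] := good_tt i.
  have Lj j : exists L : R, L.-lipschitz ((tt i).2 j) by have [] := gi j.
  have [L HL] := choice Lj.
  (* A single constant must serve all d marginals of a term; the sum of absolute values dominates
     each. *)
  exists (\sum_j `|L j|) => j -[x y] _ /=.
  have /= h := HL j (x, y) (conj I I); apply: (le_trans h); rewrite ler_wpM2r//.
  by rewrite (bigD1 j)//= (le_trans (ler_norm _))// lerDl sumr_ge0.
have [L HL] := choice lip.
exists (fun i => (tt i).1), L, (fun i => (tt i).2); last first.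
  by move=> i j; have [_ /(_ j)[]] := good_tt i.
split.
- split; first by move=> i; have [] := good_tt i.
  by rewrite /tt e_0.
- exact: mass_enum.
- by move=> i j; apply: smooth_lipschitz_pdf_is_pdf; have [_] := good_tt i.
- exact: HL.
(* Where p is non-negative, f = p, so the limit obtained for f is the required one. *)
apply: filterS2 p_ge0 mix_t => x px; rewrite (_ : f x = p x); last exact/max_idPl.
apply: (@series_enum _ _ t0 (fun y => term_fun y x) t) => //.
  by rewrite /term_fun mul0r.
by move=> n m; exact: term_fun_ge0.
Qed.
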